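(* Let $w^*\in\mathbb{R}\setminus\{0\}$, $\tau_1^{*2},\tau_2^{*2}>0$ and $y\in\mathbb{R}$. Put $\sigma_{2,Y}^2:=w^{*2}\tau_1^{*2}+\tau_2^{*2}$ and, for $\eta\in(0,1)$, $$D_{21}(\eta):=\frac12\log\left(1-\frac{\eta^2w^{*2}\tau_1^{*2}}{\eta\,\sigma_{2,Y}^2+(1-\eta)\,y^2}\right)+\frac{\eta}{2}\log\left(\frac{\sigma_{2,Y}^2}{\tau_2^{*2}}\right).$$ Then $D_{21}$ is positive and strictly concave on $(0,1)$, and $D_{21}$ achieves a unique maximum at some $\eta^*\in(0,1)$. *)

(* Defs.v *)
From mathcomp Require Import all_boot all_order all_algebra.
From mathcomp Require Import all_classical all_reals all_analysis.

Set Implicit Arguments.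
Unset Strict Implicit.
Unset Printing Implicit Defensive.

Import Order.TTheory GRing.Theory Num.Theory.

Local Open Scope classical_set_scope.
Local Open Scope ring_scope.

Definition strictly_concave_on (R : realType) (A : set R) (f : R -> R) : Prop :=
  forall x y t : R, A x -> A y -> x != y -> 0 < t -> t < 1 ->
    t * f x + (1 - t) * f y < f (t * x + (1 - t) * y).

Definition maximizer_on (R : realType) (A : set R) (f : R -> R) (x : R) : Prop :=
  A x /\ forall z : R, A z -> f z <= f x.

Definition sigma2Y_sq (R : realType) (w tau1 tau2 : R) : R :=
  w ^+ 2 * tau1 ^+ 2 + tau2 ^+ 2.

(* For eta in (0,1) and tau2 != 0, the denominator and the arguments of both
   logarithms are positive, so the conventions x / 0 = 0 and ln x = 0 for
   x <= 0 play no role there. *)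
Definition D21 (R : realType) (w tau1 tau2 y eta : R) : R :=
  2^-1 * ln (1 - (eta ^+ 2 * w ^+ 2 * tau1 ^+ 2)
                 / (eta * sigma2Y_sq w tau1 tau2 + (1 - eta) * y ^+ 2))
  + eta / 2 * ln (sigma2Y_sq w tau1 tau2 / tau2 ^+ 2).

(* Main.v *)
Require Import Defs.
From mathcomp Require Import all_boot all_order all_algebra.
From mathcomp Require Import all_classical all_reals all_analysis.
From mathcomp Require Import ring lra.

(** The statement is pure convexity on the closed interval [0, 1].  With
    S = sigma2Y_sq, a = w^2 tau1^2 and c = y^2,

      D21(eta) = ln (1 - a q(eta)) / 2 + eta (ln (S / tau2^2)) / 2,
      q(eta) = eta^2 / (eta S + (1 - eta) c).

    The function q is a square divided by an affine function, hence convex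
    ([quad_over_affine_convex]), and it increases from q(0) = 0 to q(1) = 1/S
    ([quad_over_affine_incr]).  So eta |-> 1 - a q(eta) is concave, injective,
    and bounded below by 1 - a/S = tau2^2 / S > 0.  Composing with ln, which is
    increasing and strictly concave ([strictly_concave_ln]), gives a strictly
    concave function: injectivity is what turns the strict concavity of ln into
    strict concavity of the composite.  The linear term does not affect this.

    Strict concavity holds up to the endpoints, and
    D21(0) = D21(1) = 0 because the linear term was chosen to cancel
    ln (1 - a/S) = ln (tau2^2 / S) at 1.  Positivity inside is then
    strict concavity along the chord from 0 to 1.  Finally D21 is continuous on
    [0, 1], so it attains a maximum there; being positive inside and zero at the
    ends, it attains it inside, and strict concavity makes the maximizer
    unique.

    The case y = 0 needs care only at eta = 0, where the denominator vanishes: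
    with x / 0 = 0 one has q(eta) = eta / S for every eta, so nothing degenerates
    there. *)

Import Order.TTheory GRing.Theory Num.Theory.
Import numFieldNormedType.Exports.

Local Open Scope classical_set_scope.
Local Open Scope ring_scope.

(** * Strict concavity *)

Lemma ln_lt_subr1 (R : realType) (x : R) : 0 < x -> x != 1 -> ln x < x - 1.
Proof.
move=> x0 x1; rewrite ltrBrDl -[ltRHS](@lnK _ x) ?posrE//.
apply: expR_gt1Dx; apply: contra_neq x1 => lnx0.
by rewrite -(@lnK _ x) ?posrE// lnx0 expR0.
Qed.

(** The graph of ln lies strictly below its tangent at the barycentre m, except
    at m; averaging the two tangent inequalities cancels the slope terms. *)
Lemma strictly_concave_ln (R : realType) :
  strictly_concave_on [set x : R | 0 < x] (@ln R).
Proof.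
move=> x y t /= x0 y0 xy t0 t1; set m := t * x + (1 - t) * y.
have m0 : 0 < m by rewrite addr_gt0 ?mulr_gt0 ?subr_gt0.
have tangent z : 0 < z -> z != m -> ln z < ln m + (z / m - 1).
  move=> z0 zm; rewrite -ltrBlDl -ln_div ?posrE// ln_lt_subr1 ?divr_gt0//.
  by apply: contra_neq zm => /divr1_eq.
have xm : x != m.
  rewrite -subr_eq0 (_ : x - m = (1 - t) * (x - y)); last by rewrite /m; ring.
  by rewrite mulf_neq0 ?subr_eq0// gt_eqF.
have ym : y != m.
  rewrite -subr_eq0 (_ : y - m = t * (y - x)); last by rewrite /m; ring.
  by rewrite mulf_neq0 ?(gt_eqF t0)// subr_eq0 eq_sym.
have -> : ln m = t * (ln m + (x / m - 1)) + (1 - t) * (ln m + (y / m - 1)).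
  by rewrite /m; field; rewrite gt_eqF.
by rewrite ltrD ?ltr_pM2l ?subr_gt0 ?tangent.
Qed.

(** Two distinct maximizers would be beaten by their midpoint. *)
Lemma maximizer_unique (R : realType) (A : set R) (f : R -> R) :
  (forall x y, A x -> A y -> A (2^-1 * x + (1 - 2^-1) * y)) ->
  strictly_concave_on A f ->
  forall x y, maximizer_on A f x -> maximizer_on A f y -> x = y.
Proof.
move=> Amid fconc x y [Ax xmax] [Ay ymax]; apply/eqP; apply: contraT => xy.
have h := fconc x y 2^-1 Ax Ay xy ltac:(lra) ltac:(lra).
have := xmax _ (Amid _ _ Ax Ay); have := ymax _ Ax.
by lra.
Qed.

(** * A square divided by an affine function *)

Definition quad_over_affine (R : realType) (S c x : R) : R :=
  x ^+ 2 / (x * S + (1 - x) * c).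

Section QuadOverAffine.
Variables (R : realType) (S c : R).
Hypotheses (S_gt0 : 0 < S) (c_ge0 : 0 <= c).

Local Notation q := (quad_over_affine R S c).
Local Notation L x := (x * S + (1 - x) * c).

Lemma affine_gt0 (x : R) : 0 < x -> x <= 1 -> 0 < L x.
Proof. by move=> x0 x1; rewrite ltr_wpDr ?mulr_gt0 ?mulr_ge0 ?subr_ge0. Qed.

Lemma quad_over_affine0 : q 0 = 0.
Proof. by rewrite /quad_over_affine expr0n mul0r. Qed.

Lemma quad_over_affine1 : q 1 = S^-1.
Proof. by rewrite /quad_over_affine expr1n subrr mul0r addr0 !mul1r. Qed.

(** From x^2 - 2 x s L + s^2 L^2 = (x - s L)^2 >= 0, divided by L.  The
    minorant is affine in x, with equality for s = x / L x, so the quotient is a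
    supremum of affine functions. *)
Lemma quad_over_affine_ge (x s : R) :
  0 <= x -> x <= 1 -> 2 * x * s - s ^+ 2 * L x <= q x.
Proof.
rewrite le_eqVlt => /predU1P[<- _|x0 x1].
  rewrite quad_over_affine0 mulr0 !mul0r sub0r add0r subr0 mul1r.
  by rewrite oppr_le0 mulr_ge0 ?sqr_ge0.
have L0 := affine_gt0 _ x0 x1.
rewrite ler_pdivlMr// -subr_ge0.
rewrite (_ : _ - _ = (x - s * L x) ^+ 2) ?sqr_ge0//; ring.
Qed.

Lemma quad_over_affine_convex (x y t : R) : 0 <= x -> x <= 1 -> 0 <= y -> y <= 1 ->
  0 < t -> t < 1 -> 0 < t * x + (1 - t) * y ->
  q (t * x + (1 - t) * y) <= t * q x + (1 - t) * q y.
Proof.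
move=> x0 x1 y0 y1 t0 t1; set m := _ + _ => m0.
have m1 : m <= 1 by rewrite /m; nra.
have L0 := affine_gt0 _ m0 m1.
(* The affine minorant touching q at m has parameter s = m / L m. *)
pose s := m / L m.
have -> : q m = t * (2 * x * s - s ^+ 2 * L x)
                + (1 - t) * (2 * y * s - s ^+ 2 * L y).
  transitivity (2 * m * s - s ^+ 2 * L m); last by rewrite /m; ring.
  by rewrite /s /quad_over_affine; field; rewrite gt_eqF.
by rewrite lerD ?ler_pM2l ?subr_gt0 ?quad_over_affine_ge.
Qed.

(** After clearing denominators the difference is
    (y - x) (x y S + c (x + y - x y)). *)
Lemma quad_over_affine_incr (x y : R) :
  0 <= x -> x < y -> y <= 1 -> q x < q y.
Proof.
move=> x0 xy y1; have y0 := le_lt_trans x0 xy.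
have Ly := affine_gt0 _ y0 y1.
move: x0; rewrite le_eqVlt => /predU1P[<-|x0].
  by rewrite quad_over_affine0 divr_gt0 ?exprn_gt0.
have Lx := affine_gt0 _ x0 (le_trans (ltW xy) y1).
rewrite ltr_pdivrMr// mulrAC ltr_pdivlMr// -subr_gt0.
rewrite (_ : _ - _ = (y - x) * (x * y * S + c * (x * (1 - y) + y))); last by ring.
rewrite mulr_gt0 ?subr_gt0// ltr_pwDl ?mulr_gt0// mulr_ge0//.
by rewrite addr_ge0 ?mulr_ge0 ?subr_ge0// ltW.
Qed.

Lemma quad_over_affine_le (x : R) : 0 <= x -> x <= 1 -> q x <= S^-1.
Proof.
rewrite -quad_over_affine1 => x0; rewrite le_eqVlt => /predU1P[->//|x1].
by rewrite ltW// quad_over_affine_incr.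
Qed.

Lemma quad_over_affine_continuous (x : R) :
  0 <= x -> x <= 1 -> {for x, continuous q}.
Proof.
move=> x0 x1; have [c0|cN0] := eqVneq c 0.
  (* The affine denominator is x S, and one factor x cancels, even at 0. *)
  have -> : q = (fun z => z * S^-1).
    apply/funext => z; rewrite /quad_over_affine c0 mulr0 addr0.
    have [->|z0] := eqVneq z 0; first by rewrite expr0n !mul0r.
    by field; rewrite z0 gt_eqF.
  exact: mulrr_continuous.
have L0 : 0 < L x.
  move: x0; rewrite le_eqVlt => /predU1P[<-|x0]; last exact: affine_gt0.
  by rewrite mul0r add0r subr0 mul1r lt_neqAle eq_sym cN0.
apply: cvgM; first exact: exprn_continuous.
apply: cvgV; first by rewrite gt_eqF.
apply: cvgD; first exact: mulrr_continuous.
apply: cvgM; last exact: cvg_cst.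
by apply: cvgB; [exact: cvg_cst|exact: cvg_id].
Qed.

End QuadOverAffine.

(** * The function D21 on the closed unit interval *)

Section D21.
Variables (R : realType) (w tau1 tau2 y : R).
Hypotheses (w_neq0 : w != 0) (tau1_gt0 : 0 < tau1 ^+ 2) (tau2_gt0 : 0 < tau2 ^+ 2).

Local Notation S := (sigma2Y_sq w tau1 tau2).
Local Notation a := (w ^+ 2 * tau1 ^+ 2).
Local Notation q := (quad_over_affine R S (y ^+ 2)).
Local Notation D := (D21 w tau1 tau2 y).
Local Notation u x := (1 - a * q x).

Lemma D21E (x : R) : D x = 2^-1 * ln (u x) + x / 2 * ln (S / tau2 ^+ 2).
Proof. by rewrite /D21 (_ : x ^+ 2 * _ * _ / _ = a * q x)// [RHS]mulrCA !mulrA. Qed.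

Let a_gt0 : 0 < a.
Proof. by rewrite mulr_gt0// exprn_even_gt0. Qed.

Let S_gt0 : 0 < S.
Proof. exact: addr_gt0. Qed.

Let y2_ge0 : 0 <= y ^+ 2.
Proof. exact: sqr_ge0. Qed.

Lemma D21_log_arg1 : 1 - a / S = tau2 ^+ 2 / S.
Proof. by rewrite -[1](@divff _ S) ?gt_eqF// -mulrBl /sigma2Y_sq addrC addKr. Qed.

Lemma D21_log_arg_gt0 (x : R) : 0 <= x -> x <= 1 -> 0 < u x.
Proof.
move=> x0 x1; apply: (@lt_le_trans _ _ (1 - a / S)).
  by rewrite D21_log_arg1 divr_gt0.
by rewrite lerD2l lerN2 ler_pM2l// quad_over_affine_le.
Qed.

Lemma D21_at0 : D 0 = 0.
Proof. by rewrite D21E quad_over_affine0 mulr0 subr0 ln1 !mul0r mulr0 addr0. Qed.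

Lemma D21_at1 : D 1 = 0.
Proof.
rewrite D21E quad_over_affine1 D21_log_arg1 !ln_div ?posrE//.
by ring.
Qed.

Lemma D21_strictly_concave : strictly_concave_on `[0, 1] D.
Proof.
move=> x z t /=; rewrite !in_itv/= => /andP[x0 x1] /andP[z0 z1] xz t0 t1.
set m := t * x + (1 - t) * z.
(* An endpoint may be 0, but the barycentre is not: the denominator of q is
   positive there even when y = 0. *)
have m0 : 0 < m.
  move: xz; rewrite neq_lt => /orP[xz|xz].
    have z_gt0 := le_lt_trans x0 xz.
    by rewrite ltr_wpDl ?mulr_ge0 ?mulr_gt0 ?subr_gt0// ltW.
  have x_gt0 := le_lt_trans z0 xz.
  by rewrite ltr_wpDr ?mulr_ge0 ?mulr_gt0 ?subr_ge0// ltW.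
have m1 : m <= 1 by rewrite /m; nra.
have uxz : u x != u z.
  rewrite (inj_eq (addrI _)) (inj_eq oppr_inj) (inj_eq (mulfI (lt0r_neq0 a_gt0))).
  move: xz; rewrite neq_lt => /orP[xz|xz].
    by rewrite lt_eqF// quad_over_affine_incr.
  by rewrite gt_eqF// quad_over_affine_incr.
have lnum : t * ln (u x) + (1 - t) * ln (u z) < ln (u m).
  have ux := D21_log_arg_gt0 _ x0 x1; have uz := D21_log_arg_gt0 _ z0 z1.
  apply: lt_le_trans (strictly_concave_ln R _ _ t ux uz uxz t0 t1) _.
  have uxz_gt0 : 0 < t * u x + (1 - t) * u z.
    by rewrite addr_gt0 ?mulr_gt0// subr_gt0.
  rewrite ler_ln ?posrE ?(D21_log_arg_gt0 _ (ltW m0) m1)//.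
  rewrite [leLHS](_ : _ = 1 - a * (t * q x + (1 - t) * q z)); last by ring.
  by rewrite lerD2l lerN2 ler_pM2l// quad_over_affine_convex.
rewrite !D21E /m; move: lnum; rewrite /m.
by set l := ln (S / _); lra.
Qed.

Lemma D21_gt0 (x : R) : 0 < x -> x < 1 -> 0 < D x.
Proof.
move=> x0 x1.
have := D21_strictly_concave 1 0 x; rewrite /= !in_itv/= !lexx ler01 oner_neq0.
move=> /(_ isT isT isT x0 x1).
by rewrite D21_at0 D21_at1 !mulr0 mulr1 !addr0.
Qed.

Lemma D21_continuous : {within `[0, 1], continuous D}.
Proof.
apply: continuous_in_subspaceT => x; rewrite inE/= in_itv/= => /andP[x0 x1].
rewrite (_ : D = fun z => 2^-1 * ln (u z) + z / 2 * ln (S / tau2 ^+ 2)); last first.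
  by apply/funext => z; exact: D21E.
apply: cvgD; apply: cvgM; try exact: cvg_cst; last exact: mulrr_continuous.
apply: (@continuous_comp _ _ _ (fun z => u z) (@ln R)); last first.
  exact: continuous_ln (D21_log_arg_gt0 _ x0 x1).
apply: cvgB; first exact: cvg_cst.
by apply: cvgM; [exact: cvg_cst|exact: quad_over_affine_continuous].
Qed.

Lemma D21_maximizer : exists x, maximizer_on `]0, 1[ D x.
Proof.
have [x xI xmax] := EVT_max ler01 D21_continuous.
(* The value at 1/2 is positive, which keeps x away from the endpoints. *)
have Dx0 : 0 < D x.
  apply: (@lt_le_trans _ _ (D 2^-1)); first by apply: D21_gt0; lra.
  by apply: xmax; rewrite in_itv/=; apply/andP; split; lra.
move: xI; rewrite in_itv/= => /andP[x0 x1].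
exists x; split; last first.
  move=> z /=; rewrite in_itv/= => /andP[z0 z1].
  by apply: xmax; rewrite in_itv/= !ltW.
rewrite /= in_itv/= !lt_neqAle x0 x1 !andbT; apply/andP; split.
  by apply: contraTneq Dx0 => <-; rewrite D21_at0 ltxx.
by apply: contraTneq Dx0 => ->; rewrite D21_at1 ltxx.
Qed.

End D21.

Theorem lemma4p2 (R : realType) (w tau1 tau2 y : R)
    (w_neq0 : w != 0) (tau1_gt0 : 0 < tau1 ^+ 2) (tau2_gt0 : 0 < tau2 ^+ 2) :
  [/\ forall eta : R, `]0, 1[%classic eta -> 0 < D21 w tau1 tau2 y eta,
      strictly_concave_on `]0, 1[%classic (D21 w tau1 tau2 y)
    & exists! eta_star : R,
        maximizer_on `]0, 1[%classic (D21 w tau1 tau2 y) eta_star].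
Proof.
have conc : strictly_concave_on `]0, 1[ (D21 w tau1 tau2 y).
  by move=> x z t xI zI; apply: D21_strictly_concave => //;
    exact: subset_itv_oo_cc.
split=> //.
  by move=> x /=; rewrite in_itv/= => /andP[x0 x1]; exact: D21_gt0.
have [x xmax] := D21_maximizer R w tau1 tau2 y w_neq0 tau1_gt0 tau2_gt0.
exists x; split=> // z; apply: maximizer_unique conc _ _ xmax => r s /=.
by rewrite !in_itv/= => /andP[? ?] /andP[? ?]; apply/andP; split; lra.
Qed.
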